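(* For every $\mathit{LTL}$-formula $A$, if $\models_{\mathit{LTL}} A$ then $\vdash_{\mathit{LTL}} A$.
   Context: Fix a set $\mathcal{P}$ of propositional symbols. $\mathit{LTL}$-formulas: $A ::= p \mid \bot \mid A\supset A \mid \mathsf{G}A \mid \mathsf{X}A \mid A\,\mathsf{U}\,A$. $\mathit{LTL}_\nabla$-formulas: $A ::= p \mid \bot \mid A\supset A \mid \mathsf{G}A \mid \mathsf{X}A \mid \nabla A$. Abbreviations: $\neg A := A\supset\bot$, $A\vee B := \neg A\supset B$, $A\wedge B := \neg(\neg A\vee\neg B)$, $\mathsf{F}A := \neg\mathsf{G}\neg A$. Translation $(\cdot)^*$: $p^*=p$, $\bot^*=\bot$, $(A\supset B)^*=A^*\supset B^*$, $(\mathsf{G}A)^*=\mathsf{G}A^*$, $(\mathsf{X}A)^*=\mathsf{X}A^*$, $(A\,\mathsf{U}\,B)^* = B^*\vee \mathsf{F}(\mathsf{X}B^*\wedge\nabla A^* )$. $\mathit{LTL}^l$-formulas $A^l$ and $\mathit{LTL}^{l\nabla}$-formulas $A^{l\nabla}$: $A^l ::= p \mid \bot \mid A^l\supset A^l \mid \mathsf{G}A^{l\nabla} \mid \mathsf{X}A^{l\nabla}$, $A^{l\nabla} ::= A^l \mid A^{l\nabla}\supset A^{l\nabla} \mid \nabla A^{l\nabla}$. $\mathit{LTL}$ semantics: a model is $\mathcal{M}=\langle\mathbb{N},\mathcal{V}\rangle$, $\mathcal{V}:\mathbb{N}\to2^{\mathcal{P}}$; $\mathcal{M},n\models_{\mathit{LTL}}p$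 iff $p\in\mathcal{V}(n)$; $\bot$ never true; $\supset$ classical; $\mathsf{G}A$ at $n$ iff $A$ at all $m\ge n$; $\mathsf{X}A$ at $n$ iff $A$ at $n+1$; $A\,\mathsf{U}\,B$ at $n$ iff some $n'\ge n$ has $B$ and $A$ holds at all $m$ with $n\le m<n'$. $\models_{\mathit{LTL}}A$ means $A$ holds at every point of every model. Labels: fix a denumerable set $\mathcal{L}$ of labels; sequences are elements of $\mathcal{L}^+$; labeled formulas $\alpha:A$ ($\alpha$ a sequence, $A$ an $\mathit{LTL}_\nabla$-formula); relational formulas $b\leqslant c$, $b\lhd c$; generic formula = either; in $\alpha b_1\ldots b_k$ the prefix $\alpha$ may be empty. The natural deduction system $\mathcal{N}(\mathit{LTL}_\nabla)$ (''from $X$ derived from $[H]$'' means a subderivation of $X$ in which assumptions $H$ are discharged; $\varphi[c/b]$ substitutes label $c$ for $b$): ($\bot E$) from $\alpha_2:\bot$ derived from $[\alpha_1:A\supset\bot]$ infer $\alpha_1:A$. ($\supset I$) from $\alpha:B$ derived from $[\alpha:A]$ infer $\alpha:A\supset B$. ($\supset E$) from $\alpha:A\supset B$, $\alpha:A$ infer $\alpha:B$. ($\mathsf{G}I$) from $\alpha b_1b_2:A$ derived from $[b_1\leqslant b_2]$ infer $\alpha b_1:\mathsf{G}A$. ($\mathsf{G}E$) from $\alpha b_1:\mathsf{G}A$, $b_1\leqslant b_2$ infer $\alpha b_1b_2:A$. ($\mathsf{X}I$),($\mathsf{X}E$): the same with $\mathsf{X}$ and $\lhd$. ($\nabla I$)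 from $\alpha b_1b_2:A$ derived from $[b_1\leqslant b_2],[b_2\leqslant b_3]$ infer $\alpha b_1b_3:\nabla A$. ($\nabla E$) from $\alpha b_1b_3:\nabla A$, $b_1\leqslant b_2$, $b_2\leqslant b_3$ infer $\alpha b_1b_2:A$. ($\mathit{ser}_\lhd$) from $\alpha:A$ derived from $[b_1\lhd b_2]$ infer $\alpha:A$. ($\mathit{lin}_\lhd$) from $b_1\lhd b_2$, $b_1\lhd b_3$, generic $\varphi$, and $\alpha:A$ derived from $[\varphi[b_3/b_2]]$ infer $\alpha:A$. ($\mathit{refl}_\leqslant$) from $\alpha:A$ derived from $[b_1\leqslant b_1]$ infer $\alpha:A$. ($\mathit{trans}_\leqslant$) from $b_1\leqslant b_2$, $b_2\leqslant b_3$, $\alpha:A$ derived from $[b_1\leqslant b_3]$ infer $\alpha:A$. ($\mathit{last}$) from $\beta b:A^l$ infer $\alpha b:A^l$ ($A^l$ an $\mathit{LTL}^l$-formula). ($\mathit{eq}_\leqslant$) from $b_1\leqslant b_2$, $b_2\leqslant b_1$, $\alpha b_1:A$ infer $\alpha b_2:A$. ($\mathit{split}_\leqslant$) from $b_1\leqslant b_2$, generic $\varphi$, $\alpha:A$ derived from $[\varphi[b_2/b_1]]$, and $\alpha:A$ derived from $[b_1\lhd b'],[b'\leqslant b_2]$ infer $\alpha:A$. ($\mathit{base}_\leqslant$) from $b_1\lhd b_2$, $\alpha:A$ derived from $[b_1\leqslant b_2]$ infer $\alpha:A$. ($\mathit{ind}$) from $\alpha b_0:A$, $b_0\leqslant b$,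 and $\alpha b_j:A$ derived from $[b_0\leqslant b_i],[b_i\lhd b_j],[\alpha b_i:A]$ infer $\alpha b:A$. Freshness side conditions: the discharged new label ($b_2$ in $\mathsf{G}I,\mathsf{X}I,\nabla I,\mathit{ser}_\lhd$; $b'$ in $\mathit{split}_\leqslant$; $b_i,b_j$ in $\mathit{ind}$) must differ from the other labels named in the rule and must not occur in any assumption of the corresponding premise other than the assumptions discharged by the rule. An $\mathit{LTL}$-derivation is a derivation in $\mathcal{N}(\mathit{LTL}_\nabla)$ for which there is a single label $b$ such that its conclusion and each of its open assumptions has the form $b:B^*$ for some $\mathit{LTL}$-formula $B$. $\vdash_{\mathit{LTL}}A$ means there is an $\mathit{LTL}$-derivation of $b:A^*$ with no open assumptions. *)

(* Defs.v *)
From mathcomp Require Import all_boot.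
From mathcomp Require Import classical_sets.

Set Implicit Arguments.
Unset Strict Implicit.
Unset Printing Implicit Defensive.

Local Open Scope classical_set_scope.

Inductive ltl (P : Type) : Type :=
| LVar of P
| LBot
| LImp of ltl P & ltl P
| LG of ltl P
| LX of ltl P
| LU of ltl P & ltl P.
Arguments LBot {P}.

Inductive ltln (P : Type) : Type :=
| Var of P
| Bot
| Imp of ltln P & ltln P
| G of ltln P
| X of ltln P
| Nabla of ltln P.
Arguments Bot {P}.

Definition Neg P (A : ltln P) := Imp A Bot.
Definition Or P (A B : ltln P) := Imp (Neg A) B.
Definition And P (A B : ltln P) := Neg (Or (Neg A) (Neg B)).
Definition F P (A : ltln P) := Neg (G (Neg A)).

Fixpoint star P (A : ltl P) : ltln P :=
  match A with
  | LVar p => Var p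
  | LBot => Bot
  | LImp A B => Imp (star A) (star B)
  | LG A => G (star A)
  | LX A => X (star A)
  | LU A B => Or (star B) (F (And (X (star B)) (Nabla (star A))))
  end.

Inductive is_ltl_l (P : Type) : ltln P -> Prop :=
| l_Var p : is_ltl_l (Var p)
| l_Bot : is_ltl_l Bot
| l_Imp A B : is_ltl_l A -> is_ltl_l B -> is_ltl_l (Imp A B)
| l_G A : is_ltl_ln A -> is_ltl_l (G A)
| l_X A : is_ltl_ln A -> is_ltl_l (X A)
with is_ltl_ln (P : Type) : ltln P -> Prop :=
| ln_l A : is_ltl_l A -> is_ltl_ln A
| ln_Imp A B : is_ltl_ln A -> is_ltl_ln B -> is_ltl_ln (Imp A B)
| ln_Nabla A : is_ltl_ln A -> is_ltl_ln (Nabla A).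

Definition ltl_model (P : Type) := nat -> set P.

Fixpoint ltl_sat P (V : ltl_model P) (n : nat) (A : ltl P) : Prop :=
  match A with
  | LVar p => V n p
  | LBot => False
  | LImp A B => ltl_sat V n A -> ltl_sat V n B
  | LG A => forall m, n <= m -> ltl_sat V m A
  | LX A => ltl_sat V n.+1 A
  | LU A B => exists n', [/\ n <= n', ltl_sat V n' B &
                forall m, n <= m -> m < n' -> ltl_sat V m A]
  end.

Definition ltl_valid P (A : ltl P) : Prop :=
  forall (V : ltl_model P) (n : nat), ltl_sat V n A.

(* A nonempty sequence of labels, split into its (possibly empty) prefix and
   its last label: [LSeq s b] is the sequence s b, and s b1 b2 is
   [LSeq (rcons s b1) b2]. *)
Record lseq (L : Type) : Type := LSeq { lprefix : seq L; llast : L }.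

Definition labels_of_lseq L (s : lseq L) : seq L := rcons (lprefix s) (llast s).
Coercion labels_of_lseq : lseq >-> seq.

Inductive gform (P L : Type) : Type :=
| Lab of lseq L & ltln P
| Leq of L & L
| Next of L & L.
Arguments Leq {P L} _ _.
Arguments Next {P L} _ _.

Definition labels_of_gform (P L : Type) (phi : gform P L) : seq L :=
  match phi with
  | Lab s _ => s
  | Leq b c => [:: b; c]
  | Next b c => [:: b; c]
  end.

Definition subst_label (L : eqType) (c b x : L) : L := if x == b then c else x.

(* [gsubst c b phi] is phi[c/b]: the label c is put in place of b. *)
Definition gsubst P (L : eqType) (c b : L) (phi : gform P L) : gform P L :=
  match phi with
  | Lab s A => Lab (LSeq (map (subst_label c b) (lprefix s))
                         (subst_label c b (llast s))) A
  | Leq x y => Leq (subst_label c b x) (subst_label c b y)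
  | Next x y => Next (subst_label c b x) (subst_label c b y)
  end.

Definition fresh_for P (L : eqType) (b : L) (D : set (gform P L)) : Prop :=
  forall phi, D phi -> b \notin labels_of_gform phi.

(* D is left of the open assumptions C once some occurrences (possibly none,
   possibly all) of the members of H have been discharged. *)
Definition discharge P L (H C D : set (gform P L)) : Prop :=
  D `<=` C /\ C `<=` H `|` D.

(* [nd C phi]: there is a derivation of phi whose set of open assumptions is
   exactly C.  The eigenlabel of a rule has to differ from every other label
   of the rule, including those of the sequence s in its conclusion (otherwise
   nd_ser, with nd_XE and nd_last, would derive b2 : p from b1 : X p), and must
   not occur in any assumption left open in the corresponding premise. *)
Inductive nd P (L : eqType) : set (gform P L) -> gform P L -> Prop :=
| nd_ass phi : nd [set phi] phi
| nd_botE s1 s2 A C D :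
    nd C (Lab s2 Bot) -> discharge [set Lab s1 (Imp A Bot)] C D ->
    nd D (Lab s1 A)
| nd_impI s A B C D :
    nd C (Lab s B) -> discharge [set Lab s A] C D ->
    nd D (Lab s (Imp A B))
| nd_impE s A B C1 C2 :
    nd C1 (Lab s (Imp A B)) -> nd C2 (Lab s A) ->
    nd (C1 `|` C2) (Lab s B)
| nd_GI s b1 b2 A C D :
    nd C (Lab (LSeq (rcons s b1) b2) A) -> discharge [set Leq b1 b2] C D ->
    b2 \notin b1 :: s -> fresh_for b2 D ->
    nd D (Lab (LSeq s b1) (G A))
| nd_GE s b1 b2 A C1 C2 :
    nd C1 (Lab (LSeq s b1) (G A)) -> nd C2 (Leq b1 b2) ->
    nd (C1 `|` C2) (Lab (LSeq (rcons s b1) b2) A)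
| nd_XI s b1 b2 A C D :
    nd C (Lab (LSeq (rcons s b1) b2) A) -> discharge [set Next b1 b2] C D ->
    b2 \notin b1 :: s -> fresh_for b2 D ->
    nd D (Lab (LSeq s b1) (X A))
| nd_XE s b1 b2 A C1 C2 :
    nd C1 (Lab (LSeq s b1) (X A)) -> nd C2 (Next b1 b2) ->
    nd (C1 `|` C2) (Lab (LSeq (rcons s b1) b2) A)
| nd_nablaI s b1 b2 b3 A C D :
    nd C (Lab (LSeq (rcons s b1) b2) A) ->
    discharge [set Leq b1 b2; Leq b2 b3] C D ->
    b2 \notin [:: b1, b3 & s] -> fresh_for b2 D ->
    nd D (Lab (LSeq (rcons s b1) b3) (Nabla A))
| nd_nablaE s b1 b2 b3 A C1 C2 C3 :
    nd C1 (Lab (LSeq (rcons s b1) b3) (Nabla A)) ->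
    nd C2 (Leq b1 b2) -> nd C3 (Leq b2 b3) ->
    nd (C1 `|` C2 `|` C3) (Lab (LSeq (rcons s b1) b2) A)
| nd_ser (s : lseq L) b1 b2 A C D :
    nd C (Lab s A) -> discharge [set Next b1 b2] C D ->
    b2 \notin b1 :: s -> fresh_for b2 D ->
    nd D (Lab s A)
| nd_lin s b1 b2 b3 phi A C1 C2 C3 C D :
    nd C1 (Next b1 b2) -> nd C2 (Next b1 b3) -> nd C3 phi ->
    nd C (Lab s A) -> discharge [set gsubst b3 b2 phi] C D ->
    nd (C1 `|` C2 `|` C3 `|` D) (Lab s A)
| nd_refl s b1 A C D :
    nd C (Lab s A) -> discharge [set Leq b1 b1] C D ->
    nd D (Lab s A)
| nd_trans s b1 b2 b3 A C1 C2 C D :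
    nd C1 (Leq b1 b2) -> nd C2 (Leq b2 b3) ->
    nd C (Lab s A) -> discharge [set Leq b1 b3] C D ->
    nd (C1 `|` C2 `|` D) (Lab s A)
| nd_last s t b A C :
    is_ltl_l A -> nd C (Lab (LSeq t b) A) ->
    nd C (Lab (LSeq s b) A)
| nd_eq s b1 b2 A C1 C2 C3 :
    nd C1 (Leq b1 b2) -> nd C2 (Leq b2 b1) -> nd C3 (Lab (LSeq s b1) A) ->
    nd (C1 `|` C2 `|` C3) (Lab (LSeq s b2) A)
| nd_split (s : lseq L) b1 b2 b' phi A C1 C2 C D C' D' :
    nd C1 (Leq b1 b2) -> nd C2 phi ->
    nd C (Lab s A) -> discharge [set gsubst b2 b1 phi] C D ->
    nd C' (Lab s A) -> discharge [set Next b1 b'; Leq b' b2] C' D' ->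
    b' \notin [:: b1, b2 & s] -> fresh_for b' D' ->
    nd (C1 `|` C2 `|` D `|` D') (Lab s A)
| nd_base s b1 b2 A C1 C D :
    nd C1 (Next b1 b2) ->
    nd C (Lab s A) -> discharge [set Leq b1 b2] C D ->
    nd (C1 `|` D) (Lab s A)
| nd_induction s b0 b bi bj A C1 C2 C D :
    nd C1 (Lab (LSeq s b0) A) -> nd C2 (Leq b0 b) ->
    nd C (Lab (LSeq s bj) A) ->
    discharge [set Leq b0 bi; Next bi bj; Lab (LSeq s bi) A] C D ->
    bi \notin [:: bj, b0, b & s] -> bj \notin [:: bi, b0, b & s] ->
    fresh_for bi D -> fresh_for bj D ->
    nd (C1 `|` C2 `|` D) (Lab (LSeq s b) A).

Definition ltl_form_at P L (b : L) (phi : gform P L) : Prop :=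
  exists B : ltl P, phi = Lab (LSeq [::] b) (star B).

Definition ltl_derivable P (L : eqType) (C : set (gform P L)) (phi : gform P L) : Prop :=
  nd C phi /\
  exists b : L, ltl_form_at b phi /\ forall psi, C psi -> ltl_form_at b psi.

Definition ltl_provable P (L : eqType) (A : ltl P) : Prop :=
  exists b : L, ltl_derivable set0 (Lab (LSeq [::] b) (star A)).

(* Main.v *)
From Stdlib Require List.
Require Import Defs.
From mathcomp Require Import all_boot.
From mathcomp Require Import boolp classical_sets.

(* The natural deduction system proves, at every label, the translations of the
   axioms of a Hilbert system for LTL.  A translated formula is an
   LTL^l-formula, so by [last] only the last label of a sequence matters for
   it; NABLA A occurs only strictly inside a translation, at a label sequence
   b c, where it says that A holds at every label between b and c.

   For completeness, M o X is a maximal consistent set whenever M is, but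
   iterating this map need not fulfil the eventualities of M.  One therefore
   moves between maximal consistent sets up to agreement on the subformulas Phi
   of A.  A family of maximal consistent sets that is closed under agreement on
   Phi is defined by a single formula; applied to the sets reachable from M, it
   yields an invariant, so the induction axiom shows that an eventuality of M
   is fulfilled in some reachable set.  A fair run of this graph is then a model
   of M restricted to Phi. *)

Set Implicit Arguments.
Unset Strict Implicit.
Unset Printing Implicit Defensive.

Local Open Scope classical_set_scope.

(** * Derived rules *)

Lemma exists_fresh (L : eqType) (hL : exists e : nat -> L, bijective e)
  (s : seq L) : exists b, b \notin s.
Proof.
case: hL => e /bij_inj inje; apply: contrapT => nfresh.
have sub : {subset map e (iota 0 (size s).+1) <= s}.
  by move=> b _; apply: contrapT => /negP bs; apply: nfresh; exists b.
have := uniq_leq_size _ sub.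
by rewrite map_inj_uniq // iota_uniq size_map size_iota ltnn => /(_ isT).
Qed.

(** [Nabla] enters a translation only through the clause for [LU], under the [G] hidden in [F],
    where the grammar admits it. *)
Lemma is_ltl_l_star P (A : ltl P) : is_ltl_l (star A).
Proof.
elim: A => /=; try by [constructor].
- by move=> A IHA; apply/l_G/ln_l.
- by move=> A IHA; apply/l_X/ln_l.
- have N C : is_ltl_ln C -> is_ltl_ln (Neg C).
    by move=> ?; apply: ln_Imp => //; apply/ln_l/l_Bot.
  move=> A IHA B IHB; apply: l_Imp; first by do ?constructor.
  apply: l_Imp; last by constructor.
  apply/l_G/N/N/ln_Imp.
    by apply/N/N/ln_l/l_X/ln_l.
  by apply/N/ln_Nabla/ln_l.
Qed.

(** [nd] records the exact set of open assumptions; bounding that set by a list gives weakening and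
    turns freshness into a check on the list. *)
Definition entails P (L : eqType) (Gam : seq (gform P L)) (phi : gform P L) :=
  exists2 C, nd C phi & forall psi, C psi -> List.In psi Gam.

Definition fresh_in P (L : eqType) (b : L) (Gam : seq (gform P L)) :=
  all (fun phi => b \notin labels_of_gform phi) Gam.

Definition ctx P L (Gam : seq (gform P L)) : set (gform P L) :=
  fun psi => List.In psi Gam.

Section DerivedRules.
Variables (P : Type) (L : eqType).
Implicit Types (Gam : seq (gform P L)) (phi : gform P L) (A B : ltln P).
Implicit Types (s t : seq L) (b c : L).

(** An assumption lying both in [H] and in [Gam] is kept open, which [discharge] permits. *)
Lemma dischargeI (H C : set (gform P L)) Gam :
  (forall psi, C psi -> H psi \/ List.In psi Gam) ->
  discharge H C (C `&` ctx Gam).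
Proof.
move=> sub; split=> [psi []//|psi Cpsi].
by case: (sub _ Cpsi) => ?; [left|right].
Qed.

Lemma discharge1 phi (C : set (gform P L)) Gam :
  (forall psi, C psi -> List.In psi (phi :: Gam)) ->
  discharge [set phi] C (C `&` ctx Gam).
Proof. by move=> CG; apply: dischargeI => psi /CG /= [<-|]; [left|right]. Qed.

Lemma fresh_forI b (C : set (gform P L)) Gam :
  fresh_in b Gam -> fresh_for b (C `&` ctx Gam).
Proof.
move=> frG psi [_]; elim: Gam frG => //= phi Gam IH /andP[fr frG].
by case=> [<-//|]; exact: IH.
Qed.

Lemma entails_ass Gam phi : List.In phi Gam -> entails Gam phi.
Proof. by move=> ?; exists [set phi]; [exact: nd_ass|move=> _ ->]. Qed.

Lemma entails_weaken Gam Del phi :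
  (forall psi, List.In psi Gam -> List.In psi Del) ->
  entails Gam phi -> entails Del phi.
Proof. by move=> sub [C ? CG]; exists C => // psi /CG/sub. Qed.

Lemma entails_cons Gam phi psi : entails Gam phi -> entails (psi :: Gam) phi.
Proof. by apply: entails_weaken => ?; right. Qed.

Lemma entails_botE Gam s b t c A :
  entails (Lab (LSeq s b) (Imp A Bot) :: Gam) (Lab (LSeq t c) Bot) ->
  entails Gam (Lab (LSeq s b) A).
Proof.
case=> C dC CG; exists (C `&` ctx Gam); last by move=> psi [].
exact: nd_botE dC (discharge1 CG).
Qed.

Lemma entails_impI Gam s b A B :
  entails (Lab (LSeq s b) A :: Gam) (Lab (LSeq s b) B) ->
  entails Gam (Lab (LSeq s b) (Imp A B)).
Proof.
case=> C dC CG; exists (C `&` ctx Gam); last by move=> psi [].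
exact: nd_impI dC (discharge1 CG).
Qed.

Lemma entails_impE Gam s b A B :
  entails Gam (Lab (LSeq s b) (Imp A B)) -> entails Gam (Lab (LSeq s b) A) ->
  entails Gam (Lab (LSeq s b) B).
Proof.
case=> [C1 d1 G1] [C2 d2 G2]; exists (C1 `|` C2); first exact: nd_impE d1 d2.
by move=> psi [/G1|/G2].
Qed.

Lemma entails_GI Gam s b c A :
  c \notin b :: s -> fresh_in c Gam ->
  entails (Leq b c :: Gam) (Lab (LSeq (rcons s b) c) A) ->
  entails Gam (Lab (LSeq s b) (G A)).
Proof.
move=> cs cG [C dC CG]; exists (C `&` ctx Gam); last by move=> psi [].
apply: (nd_GI dC _ cs); last exact: fresh_forI.
exact: discharge1 CG.
Qed.

Lemma entails_GE Gam s b c A :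
  entails Gam (Lab (LSeq s b) (G A)) -> entails Gam (Leq b c) ->
  entails Gam (Lab (LSeq (rcons s b) c) A).
Proof.
case=> [C1 d1 G1] [C2 d2 G2]; exists (C1 `|` C2); first exact: nd_GE d1 d2.
by move=> psi [/G1|/G2].
Qed.

Lemma entails_XI Gam s b c A :
  c \notin b :: s -> fresh_in c Gam ->
  entails (Next b c :: Gam) (Lab (LSeq (rcons s b) c) A) ->
  entails Gam (Lab (LSeq s b) (X A)).
Proof.
move=> cs cG [C dC CG]; exists (C `&` ctx Gam); last by move=> psi [].
apply: (nd_XI dC _ cs); last exact: fresh_forI.
exact: discharge1 CG.
Qed.

Lemma entails_XE Gam s b c A :
  entails Gam (Lab (LSeq s b) (X A)) -> entails Gam (Next b c) ->
  entails Gam (Lab (LSeq (rcons s b) c) A).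
Proof.
case=> [C1 d1 G1] [C2 d2 G2]; exists (C1 `|` C2); first exact: nd_XE d1 d2.
by move=> psi [/G1|/G2].
Qed.

Lemma entails_nablaI Gam s b c d A :
  c \notin [:: b, d & s] -> fresh_in c Gam ->
  entails [:: Leq b c, Leq c d & Gam] (Lab (LSeq (rcons s b) c) A) ->
  entails Gam (Lab (LSeq (rcons s b) d) (Nabla A)).
Proof.
move=> cs cG [C dC CG]; exists (C `&` ctx Gam); last by move=> psi [].
apply: (nd_nablaI dC _ cs); last exact: fresh_forI.
by apply: (dischargeI (Gam := Gam)) => psi /CG /= [<-|[<-|]];
  [left; left|left; right|right].
Qed.

Lemma entails_nablaE Gam s b c d A :
  entails Gam (Lab (LSeq (rcons s b) d) (Nabla A)) ->
  entails Gam (Leq b c) -> entails Gam (Leq c d) ->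
  entails Gam (Lab (LSeq (rcons s b) c) A).
Proof.
case=> [C1 d1 G1] [C2 d2 G2] [C3 d3 G3]; eexists.
  exact: nd_nablaE d1 d2 d3.
by move=> psi [[/G1|/G2]|/G3].
Qed.

Lemma entails_ser Gam b c (t : lseq L) A :
  c \notin b :: t -> fresh_in c Gam ->
  entails (Next b c :: Gam) (Lab t A) -> entails Gam (Lab t A).
Proof.
move=> cs cG [C dC CG]; exists (C `&` ctx Gam); last by move=> psi [].
apply: (nd_ser dC _ cs); last exact: fresh_forI.
exact: discharge1 CG.
Qed.

Lemma entails_lin Gam b c d phi (t : lseq L) A :
  entails Gam (Next b c) -> entails Gam (Next b d) -> entails Gam phi ->
  entails (gsubst d c phi :: Gam) (Lab t A) -> entails Gam (Lab t A).
Proof.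
case=> [C1 d1 G1] [C2 d2 G2] [C3 d3 G3] [C dC CG]; eexists.
  exact: nd_lin d1 d2 d3 dC (discharge1 CG).
by move=> psi [[[/G1|/G2]|/G3]|[]].
Qed.

Lemma entails_refl Gam b (t : lseq L) A :
  entails (Leq b b :: Gam) (Lab t A) -> entails Gam (Lab t A).
Proof.
case=> C dC CG; exists (C `&` ctx Gam); last by move=> psi [].
exact: nd_refl dC (discharge1 CG).
Qed.

Lemma entails_trans Gam b c d (t : lseq L) A :
  entails Gam (Leq b c) -> entails Gam (Leq c d) ->
  entails (Leq b d :: Gam) (Lab t A) -> entails Gam (Lab t A).
Proof.
case=> [C1 d1 G1] [C2 d2 G2] [C dC CG]; eexists.
  exact: nd_trans d1 d2 dC (discharge1 CG).
by move=> psi [[/G1|/G2]|[]].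
Qed.

Lemma entails_last Gam t s b A :
  is_ltl_l A -> entails Gam (Lab (LSeq t b) A) ->
  entails Gam (Lab (LSeq s b) A).
Proof. by move=> lA [C dC CG]; exists C => //; exact: nd_last dC. Qed.

Lemma entails_eq Gam s b c A :
  entails Gam (Leq b c) -> entails Gam (Leq c b) ->
  entails Gam (Lab (LSeq s b) A) -> entails Gam (Lab (LSeq s c) A).
Proof.
case=> [C1 d1 G1] [C2 d2 G2] [C3 d3 G3]; eexists; first exact: nd_eq d1 d2 d3.
by move=> psi [[/G1|/G2]|/G3].
Qed.

Lemma entails_split Gam b c d phi (t : lseq L) A :
  d \notin [:: b, c & t] -> fresh_in d Gam ->
  entails Gam (Leq b c) -> entails Gam phi ->
  entails (gsubst c b phi :: Gam) (Lab t A) ->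
  entails [:: Next b d, Leq d c & Gam] (Lab t A) ->
  entails Gam (Lab t A).
Proof.
move=> dt dG [C1 d1 G1] [C2 d2 G2] [C3 d3 G3] [C4 d4 G4]; eexists.
  apply: (nd_split d1 d2 d3 _ d4 _ dt).
  - exact: discharge1 G3.
  - apply: (dischargeI (Gam := Gam)) => psi /G4 /= [<-|[<-|]];
      by [left; left|left; right|right].
  - exact: fresh_forI.
by move=> psi [[[/G1|/G2]|[]]|[]].
Qed.

Lemma entails_base Gam b c (t : lseq L) A :
  entails Gam (Next b c) ->
  entails (Leq b c :: Gam) (Lab t A) -> entails Gam (Lab t A).
Proof.
case=> [C1 d1 G1] [C dC CG]; eexists.
  exact: nd_base d1 dC (discharge1 CG).
by move=> psi [/G1|[]].
Qed.

Lemma entails_ind Gam s b c x y A :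
  x \notin [:: y, b, c & s] -> y \notin [:: x, b, c & s] ->
  fresh_in x Gam -> fresh_in y Gam ->
  entails Gam (Lab (LSeq s b) A) -> entails Gam (Leq b c) ->
  entails [:: Leq b x, Next x y, Lab (LSeq s x) A & Gam] (Lab (LSeq s y) A) ->
  entails Gam (Lab (LSeq s c) A).
Proof.
move=> xs ys xG yG [C1 d1 G1] [C2 d2 G2] [C3 d3 G3]; eexists.
  apply: (nd_induction d1 d2 d3 _ xs ys).
  - apply: (dischargeI (Gam := Gam)) => psi /G3 /= [<-|[<-|[<-|]]];
      by [left; left; left|left; left; right|left; right|right].
  - exact: fresh_forI.
  - exact: fresh_forI.
by move=> psi [[/G1|/G2]|[]].
Qed.

End DerivedRules.

Ltac assumed := apply: entails_ass; rewrite /=; tauto.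
Ltac weakened H := apply: entails_weaken H => ? /=; tauto.

(** * Derived rules for the classical connectives and [F] *)

Section DerivedConnectives.
Variables (P : Type) (L : eqType).
Implicit Types (Gam : seq (gform P L)) (A B C : ltln P).
Implicit Types (s t : seq L) (b c : L).

Lemma entails_efq Gam s b t c A :
  entails Gam (Lab (LSeq t c) Bot) -> entails Gam (Lab (LSeq s b) A).
Proof.
by move=> H; apply: (@entails_botE _ _ _ _ _ t c); apply: entails_cons.
Qed.

Lemma entails_refute Gam s b t c A :
  entails (Lab (LSeq s b) A :: Gam) (Lab (LSeq t c) Bot) ->
  entails Gam (Lab (LSeq s b) (Neg A)).
Proof. by move=> H; apply: entails_impI; apply: entails_efq H. Qed.

(** The two label sequences may differ, so introducing and eliminating an implication is not
    possible; the argument goes by contradiction, because falsum may change its labels in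
    [nd_botE]. *)
Lemma entails_cut Gam s b t c A C :
  entails Gam (Lab (LSeq s b) A) ->
  entails (Lab (LSeq s b) A :: Gam) (Lab (LSeq t c) C) ->
  entails Gam (Lab (LSeq t c) C).
Proof.
move=> HA HC; apply: (@entails_botE _ _ _ _ _ s b).
apply: entails_impE (entails_cons _ HA); apply: (@entails_refute _ _ _ t c).
by apply: (@entails_impE _ _ _ _ _ C); [assumed|weakened HC].
Qed.

Lemma entails_orI1 Gam s b A B :
  entails Gam (Lab (LSeq s b) A) -> entails Gam (Lab (LSeq s b) (Or A B)).
Proof.
move=> HA; apply: entails_impI; apply: (@entails_efq _ s b s b).
by apply: (@entails_impE _ _ _ _ _ A); [assumed|exact: entails_cons].
Qed.

Lemma entails_orI2 Gam s b A B :
  entails Gam (Lab (LSeq s b) B) -> entails Gam (Lab (LSeq s b) (Or A B)).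
Proof. by move=> HB; apply: entails_impI; exact: entails_cons. Qed.

Lemma entails_orE Gam s b t c A B C :
  entails Gam (Lab (LSeq s b) (Or A B)) ->
  entails (Lab (LSeq s b) A :: Gam) (Lab (LSeq t c) C) ->
  entails (Lab (LSeq s b) B :: Gam) (Lab (LSeq t c) C) ->
  entails Gam (Lab (LSeq t c) C).
Proof.
move=> HAB HA HB; apply: (@entails_botE _ _ _ _ _ t c).
apply: (@entails_impE _ _ _ _ _ C); first by assumed.
apply: (@entails_cut _ s b _ _ B); last by weakened HB.
apply: entails_impE (entails_cons _ HAB) _; apply: (@entails_refute _ _ _ t c).
by apply: (@entails_impE _ _ _ _ _ C); [assumed|weakened HA].
Qed.

Lemma entails_andI Gam s b A B :
  entails Gam (Lab (LSeq s b) A) -> entails Gam (Lab (LSeq s b) B) ->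
  entails Gam (Lab (LSeq s b) (And A B)).
Proof.
move=> HA HB; apply: entails_impI.
apply: (@entails_orE _ s b _ _ (Neg A) (Neg B)); first by assumed.
- by apply: (@entails_impE _ _ _ _ _ A); [assumed|weakened HA].
- by apply: (@entails_impE _ _ _ _ _ B); [assumed|weakened HB].
Qed.

Lemma entails_andE1 Gam s b A B :
  entails Gam (Lab (LSeq s b) (And A B)) -> entails Gam (Lab (LSeq s b) A).
Proof.
move=> H; apply: (@entails_botE _ _ _ _ _ s b).
apply: entails_impE (entails_cons _ H) _; apply: entails_orI1; assumed.
Qed.

Lemma entails_andE2 Gam s b A B :
  entails Gam (Lab (LSeq s b) (And A B)) -> entails Gam (Lab (LSeq s b) B).
Proof.
move=> H; apply: (@entails_botE _ _ _ _ _ s b).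
apply: entails_impE (entails_cons _ H) _; apply: entails_orI2; assumed.
Qed.

Lemma entails_FI Gam s b c A :
  entails Gam (Leq b c) -> entails Gam (Lab (LSeq (rcons s b) c) A) ->
  entails Gam (Lab (LSeq s b) (F A)).
Proof.
move=> bc HA; apply: (@entails_refute _ _ _ (rcons s b) c).
apply: entails_impE (entails_cons _ HA).
by apply: entails_GE (entails_cons _ bc); assumed.
Qed.

(** The label [c] must also avoid the conclusion: in the argument by contradiction, the negated
    conclusion is an open assumption when [G] is introduced. *)
Lemma entails_FE Gam s b c t d A C :
  c \notin b :: s -> c \notin rcons t d -> fresh_in c Gam ->
  entails Gam (Lab (LSeq s b) (F A)) ->
  entails [:: Lab (LSeq (rcons s b) c) A, Leq b c & Gam] (Lab (LSeq t d) C) ->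
  entails Gam (Lab (LSeq t d) C).
Proof.
move=> cs ct cG HF HC; apply: (@entails_botE _ _ _ _ _ s b).
apply: entails_impE (entails_cons _ HF) _.
apply: (@entails_GI _ _ _ _ _ c) => //; first by rewrite /= ct.
apply: (@entails_refute _ _ _ t d).
by apply: (@entails_impE _ _ _ _ _ C); [assumed|weakened HC].
Qed.

End DerivedConnectives.

Ltac known_neq :=
  repeat match goal with
  | H : (?x == ?y) = false |- context [?x == ?y] => rewrite H
  end.

Ltac is_fresh :=
  rewrite /= ?inE ?negb_or;
  known_neq; by [].

(** * Theorems of a Hilbert system *)

Section HilbertSystem.
Variables (P : Type) (L : eqType).
Hypothesis infL : exists e : nat -> L, bijective e.

(** The disequations are kept in both orders, since freshness goals and [subst_label] may compare
    two labels either way round. *)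
Ltac fresh_label c l :=
  let H := fresh in let H' := fresh in
  have [c H] := exists_fresh infL l;
  have H' := H; rewrite ?inE ?negb_or in H;
  rewrite ?inE ?negb_or in H';
  repeat match type of H with
  | is_true (_ && _) =>
      let K := fresh in case/andP: H => K H; move/negbTE: K => K
  end; move/negbTE: H => H;
  repeat match type of H' with
  | is_true (_ && _) => let K := fresh in case/andP: H' => K H';
      rewrite eq_sym in K; move/negbTE: K => K
  end; rewrite eq_sym in H'; move/negbTE: H' => H'.

(** Quantification over all labels serves necessitation: the derivation is taken at the fresh label,
    and [last] then supplies the prefix. *)
Definition provable (A : ltl P) :=
  forall b : L, @entails P L [::] (Lab (LSeq [::] b) (star A)).

Lemma provable_mp A B : provable (LImp A B) -> provable A -> provable B.
Proof. by move=> AB HA b; exact: entails_impE (AB b) (HA b). Qed.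

Lemma provable_K A B : provable (LImp A (LImp B A)).
Proof. by move=> b; do 2!apply: entails_impI; assumed. Qed.

Lemma provable_S A B C :
  provable (LImp (LImp A (LImp B C)) (LImp (LImp A B) (LImp A C))).
Proof.
move=> b; do 3!apply: entails_impI.
apply: (@entails_impE _ _ _ _ _ (star B)).
  by apply: (@entails_impE _ _ _ _ _ (star A)); assumed.
by apply: (@entails_impE _ _ _ _ _ (star A)); assumed.
Qed.

Lemma provable_DNE A : provable (LImp (LImp (LImp A LBot) LBot) A).
Proof.
move=> b; apply: entails_impI; apply: (@entails_botE _ _ _ _ _ [::] b).
by apply: (@entails_impE _ _ _ _ _ (Neg (star A))); assumed.
Qed.

Let last_star Gam t s b (A : ltl P) :
  @entails P L Gam (Lab (LSeq t b) (star A)) ->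
  entails Gam (Lab (LSeq s b) (star A)).
Proof. exact/entails_last/is_ltl_l_star. Qed.

Lemma provable_necX A : provable A -> provable (LX A).
Proof.
move=> HA b; fresh_label c [:: b].
apply: (@entails_XI _ _ _ _ _ c); [is_fresh..|].
apply: last_star; apply: entails_cons; exact: HA.
Qed.

Lemma provable_necG A : provable A -> provable (LG A).
Proof.
move=> HA b; fresh_label c [:: b].
apply: (@entails_GI _ _ _ _ _ c); [is_fresh..|].
apply: last_star; apply: entails_cons; exact: HA.
Qed.

Lemma provable_KX A B :
  provable (LImp (LX (LImp A B)) (LImp (LX A) (LX B))).
Proof.
move=> b; fresh_label c [:: b]; do 2!apply: entails_impI.
apply: (@entails_XI _ _ _ _ _ c); [is_fresh..|].
by apply: (@entails_impE _ _ _ _ _ (star A)); apply: entails_XE; assumed.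
Qed.

Lemma provable_KG A B :
  provable (LImp (LG (LImp A B)) (LImp (LG A) (LG B))).
Proof.
move=> b; fresh_label c [:: b]; do 2!apply: entails_impI.
apply: (@entails_GI _ _ _ _ _ c); [is_fresh..|].
by apply: (@entails_impE _ _ _ _ _ (star A)); apply: entails_GE; assumed.
Qed.

Lemma provable_XBot : provable (LImp (LX LBot) LBot).
Proof.
move=> b; fresh_label c [:: b]; apply: entails_impI.
apply: (@entails_ser _ _ _ b c); [is_fresh..|].
apply: (@entails_efq _ _ _ _ _ [:: b] c).
by apply: (@entails_XE _ _ _ [::]); assumed.
Qed.

(** Successors are unique: if A held at the successor [c], then [lin] would carry it to an arbitrary
    successor [d], giving X A at [b]. *)
Lemma provable_negX A :
  provable (LImp (LImp (LX A) LBot) (LX (LImp A LBot))).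
Proof.
move=> b; fresh_label c [:: b]; fresh_label d [:: b; c]; apply: entails_impI.
apply: (@entails_XI _ _ _ _ _ c); [is_fresh..|].
apply: (@entails_refute _ _ _ _ _ [::] b).
apply: (@entails_impE _ _ _ _ _ (X (star A))); first by assumed.
apply: (@entails_XI _ _ _ _ _ d); [is_fresh..|].
apply: (@entails_lin _ _ _ b c d (Lab (LSeq [::] c) (star A))); try assumed.
  by apply: (last_star (t := [:: b])); assumed.
by apply: (last_star (t := [::])); rewrite /= /subst_label eqxx; assumed.
Qed.

Lemma provable_GE A : provable (LImp (LG A) A).
Proof.
move=> b; apply: entails_impI; apply: (@entails_refl _ _ _ b).
by apply: (last_star (t := [:: b])); apply: (@entails_GE _ _ _ [::]); assumed.
Qed.

Lemma provable_GXG A : provable (LImp (LG A) (LX (LG A))).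
Proof.
move=> b; fresh_label c [:: b]; fresh_label d [:: b; c]; apply: entails_impI.
apply: (@entails_XI _ _ _ _ _ c); [is_fresh..|].
apply: (@entails_GI _ _ _ _ _ d); [is_fresh..|].
apply: (@entails_base _ _ _ b c); first by assumed.
apply: (@entails_trans _ _ _ b c d); [assumed..|].
by apply: (last_star (t := [:: b])); apply: (@entails_GE _ _ _ [::]); assumed.
Qed.

Lemma provable_ind A :
  provable (LImp (LG (LImp A (LX A))) (LImp A (LG A))).
Proof.
move=> b; fresh_label c [:: b]; fresh_label x [:: b; c].
fresh_label y [:: b; c; x]; do 2!apply: entails_impI.
apply: (@entails_GI _ _ _ _ _ c); [is_fresh..|].
apply: (@entails_ind _ _ _ _ b c x y); [is_fresh..| |assumed|].
  by apply: (last_star (t := [::])); assumed.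
apply: (last_star (t := [:: b; x])).
apply: (@entails_XE _ _ _ [:: b]); last by assumed.
apply: (@entails_impE _ _ _ _ _ (star A)); last by assumed.
by apply: (@entails_GE _ _ _ [::]); assumed.
Qed.

Lemma provable_UI1 A B : provable (LImp B (LU A B)).
Proof. by move=> b; apply: entails_impI; apply: entails_orI1; assumed. Qed.

(** In the second disjunct of the translation, the witness of [F] is the moment just before B, and A
    holds from now up to and including that moment. *)
Lemma provable_UI2 A B : provable (LImp A (LImp (LX (LU A B)) (LU A B))).
Proof.
move=> b; fresh_label c [:: b]; fresh_label d [:: b; c].
fresh_label x [:: b; c; d]; fresh_label y [:: b; c; d; x].
do 2!apply: entails_impI.
apply: (@entails_ser _ _ _ b c); [is_fresh..|].
apply: (@entails_orE _ _ _ [:: b] c _ _ (star B)).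
- by apply: (@entails_XE _ _ _ [::]); assumed.
(* B holds at the successor [c], so [b] itself is the witness. *)
- apply: entails_orI2; apply: (@entails_refl _ _ _ b).
  apply: (@entails_FI _ _ _ _ _ b); first by assumed.
  apply: entails_andI.
  + apply: (@entails_XI _ _ _ _ _ d); [is_fresh..|].
    apply: (@entails_lin _ _ _ b c d (Lab (LSeq [::] c) (star B))); try assumed.
      by apply: (last_star (t := [:: b])); assumed.
    by apply: (last_star (t := [::])); rewrite /= /subst_label eqxx; assumed.
  + apply: (@entails_nablaI _ _ _ [::] _ x); [is_fresh..|].
    (* A label between [b] and [b] equals [b]. *)
    apply: (@entails_eq _ _ _ _ b); [assumed..|].
    by apply: (last_star (t := [::])); assumed.
(* The witness [d] for [c] also serves for [b]. *)
- apply: (@entails_FE _ _ _ [:: b] c d); [is_fresh..|assumed|].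
  apply: entails_orI2; apply: (@entails_base _ _ _ b c); first by assumed.
  apply: (@entails_trans _ _ _ b c d); [assumed..|].
  apply: (@entails_FI _ _ _ _ _ d); first by assumed.
  apply: entails_andI.
    apply: (@last_star _ [:: b; c] _ _ (LX B)).
    by apply: entails_andE1; assumed.
  apply: (@entails_nablaI _ _ _ [::] _ x); [is_fresh..|].
  (* Either [x] is [b], where A is assumed, or [x] lies at or after a successor [y] of [b]. *)
  apply: (@entails_split _ _ _ b x y (Lab (LSeq [::] b) (star A)));
    [is_fresh..|assumed|assumed| |].
    by apply: (last_star (t := [::])); rewrite /= /subst_label eqxx; assumed.
  (* [y] is identified with [c], so [x] lies between [c] and [d], where [Nabla] yields A. *)
  apply: (@entails_lin _ _ _ b y c (Leq y x)); [assumed..|].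
  rewrite /= /subst_label eqxx; known_neq.
  apply: (last_star (t := [:: b; c])).
  by apply: (@entails_nablaE _ _ _ [:: b] _ _ d);
    [apply: entails_andE2|..]; assumed.
Qed.

Lemma provable_UE1 A B :
  provable (LImp (LU A B) (LImp (LImp B LBot) A)).
Proof.
move=> b; fresh_label c [:: b]; do 2!apply: entails_impI.
apply: (@entails_FE _ _ _ [::] b c); [is_fresh..| |].
  by apply: (@entails_impE _ _ _ _ _ (Neg (star B))); assumed.
apply: (@entails_refl _ _ _ b); apply: (last_star (t := [:: b])).
by apply: (@entails_nablaE _ _ _ [::] _ _ c);
  [apply: entails_andE2|..]; assumed.
Qed.

(** Let [d] be the witness of [F] and [c] the successor of [b]. If [d] is [b], then B holds at [c];
    otherwise [d] is not before [c] and is a witness for [c] as well. *)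
Lemma provable_UE2 A B :
  provable (LImp (LU A B) (LImp (LImp B LBot) (LX (LU A B)))).
Proof.
move=> b; fresh_label d [:: b]; fresh_label c [:: b; d].
fresh_label x [:: b; c; d]; fresh_label y [:: b; c; d; x].
do 2!apply: entails_impI.
apply: (@entails_XI _ _ _ _ _ c); [is_fresh..|].
apply: (@entails_FE _ _ _ [::] b d); [is_fresh..| |].
  by apply: (@entails_impE _ _ _ _ _ (Neg (star B))); assumed.
apply: (@entails_split _ _ _ b d y (Next b c));
  [is_fresh..|assumed|assumed| |].
- rewrite /= /subst_label eqxx; known_neq.
  apply: entails_orI1; apply: (last_star (t := [:: b; d])).
  by apply: (@entails_XE _ _ _ [:: b]); [apply: entails_andE1|]; assumed.
- apply: (@entails_lin _ _ _ b y c (Leq y d)); [assumed..|].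
  rewrite /= /subst_label eqxx; known_neq.
  apply: entails_orI2; apply: (@entails_FI _ _ _ _ _ d); first by assumed.
  apply: entails_andI.
    apply: (@last_star _ [:: b] _ _ (LX B)).
    by apply: entails_andE1; assumed.
  apply: (@entails_nablaI _ _ _ _ _ x); [is_fresh..|].
  apply: (@entails_base _ _ _ b c); first by assumed.
  apply: (@entails_trans _ _ _ b c x); [assumed..|].
  apply: (last_star (t := [:: b])).
  by apply: (@entails_nablaE _ _ _ [::] _ _ d);
    [apply: entails_andE2|..]; assumed.
Qed.

Lemma provable_UE3 A B :
  provable (LImp (LU A B) (LImp (LG (LImp B LBot)) LBot)).
Proof.
move=> b; fresh_label d [:: b]; fresh_label c [:: b; d].
do 2!apply: entails_impI.
apply: (@entails_orE _ _ _ [::] b _ _ (star B)); first by assumed.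
- apply: (@entails_impE _ _ _ _ _ (star B)); last by assumed.
  apply: (@entails_refl _ _ _ b).
  apply: (@last_star _ [:: b] _ _ (LImp B LBot)).
  by apply: (@entails_GE _ _ _ [::]); assumed.
- apply: (@entails_FE _ _ _ [::] b d); [is_fresh..|assumed|].
  apply: (@entails_ser _ _ _ d c); [is_fresh..|].
  apply: (@entails_base _ _ _ d c); first by assumed.
  apply: (@entails_trans _ _ _ b d c); [assumed..|].
  apply: (@entails_efq _ _ _ _ _ [:: b] c).
  apply: (@entails_impE _ _ _ _ _ (star B)).
    by apply: (@entails_GE _ _ _ [::]); assumed.
  apply: (last_star (t := [:: b; d])).
  by apply: (@entails_XE _ _ _ [:: b]); [apply: entails_andE1|]; assumed.
Qed.

End HilbertSystem.

(** * Fair runs *)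

Section FairRun.
Variables (W : Type) (e : W -> W -> Prop).
Hypothesis e_total : forall w, exists v, e w v.

Fixpoint reach (T : W -> Prop) n w :=
  if n is n'.+1 then exists2 v, e w v & reach T n' v else T w.

(** Every pursuit of a target ends, so the counter passes through all later indices. A target that
    recurs in the enumeration is thus served after time [i], and if it stays reachable its pursuit
    can only end by hitting it. *)
Lemma fair_run (T : nat -> W -> Prop) (w0 : W) :
  exists sigma : nat -> W, [/\ sigma 0 = w0,
    forall i, e (sigma i) (sigma i.+1) &
    forall k i, (forall c, exists2 d, c <= d & T d = T k) ->
      (forall j, i <= j -> exists n, reach (T k) n (sigma j)) ->
      exists2 j, i <= j & T k (sigma j)].
Proof.
(* A state (w, c) of the run pursues the target T c along a shortest path, and
   c is incremented once T c is reached or unreachable. *)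
pose done wc := T wc.2 wc.1 \/ forall n, ~ reach (T wc.2) n wc.1.
pose step (wc vd : W * nat) := [/\ e wc.1 vd.1,
  done wc -> vd.2 = wc.2.+1 &
  ~ done wc -> vd.2 = wc.2 /\
    forall n, reach (T wc.2) n.+1 wc.1 ->
    (forall m, m <= n -> ~ reach (T wc.2) m wc.1) -> reach (T wc.2) n vd.1].
have stepP wc : exists vd, step wc vd.
  have [dwc|ndwc] := pselect (done wc).
    by have [v ev] := e_total wc.1; exists (v, wc.2.+1).
  have exr : exists n, `[<reach (T wc.2) n wc.1>].
    apply: contrapT => nr; apply: ndwc; right=> n r.
    by apply: nr; exists n; apply/asboolP.
  case: (ex_minnP exr) => -[/asboolP r _|n /asboolP r minn].
    by case: ndwc; left.
  have [v ev rv] := r; exists (v, wc.2); split=> // _.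
  split=> // m [u eu ru] minm.
  (* Both [m.+1] and [n.+1] are the least distance to the target. *)
  have -> : m = n; last by [].
  apply/eqP; rewrite eqn_leq; apply/andP; split.
    rewrite leqNgt; apply/negP => nm; exact: (minm _ nm).
  have : `[<reach (T wc.2) m.+1 wc.1>] by apply/asboolP; exists u.
  by move=> /minn.
pose f wc := projT1 (cid (stepP wc)).
have fP wc : step wc (f wc) by exact: projT2 (cid (stepP wc)).
pose s i := iter i f (w0, 0).
exists (fun i => (s i).1); split=> // [i|k i recur reachk].
  by case: (fP (s i)).
have stepS j : step (s j) (s j.+1) by exact: fP.
have ends j : exists2 j', j <= j' & (s j').2 = (s j).2 /\ done (s j').
  have [nr|] := pselect (forall n, ~ reach (T (s j).2) n (s j).1).
    by exists j => //; split=> //; right.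
  (* Strong induction on the length of a path to the current target: if no shorter path exists,
     [step] moves one closer along a shortest one. *)
  move=> /existsNP[n /contrapT]; elim/ltn_ind: n j => n IH j rn.
  have [dj|ndj] := pselect (done (s j)); first by exists j.
  have [[m mn rm]|nm] :=
    pselect (exists2 m, m < n & reach (T (s j).2) m (s j).1).
    exact: IH rm.
  case: n => [|n] in IH rn nm *; first by case: ndj; left.
  have [_ _ /(_ ndj)[cj rj]] := stepS j.
  have [||j' jj' [cj' dj']] := IH n _ j.+1 => //.
    rewrite cj; apply: rj => // m mn rm; by apply: nm; exists m.
  by exists j'; [exact: ltnW|rewrite cj' cj].
have counter d : exists2 j, i <= j & (s j).2 = (s i).2 + d.
  elim: d => [|d [j ij cj]]; first by exists i; rewrite ?addn0.
  have [j' jj' [cj' dj']] := ends j.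
  exists j'.+1; first by rewrite (leq_trans ij) // (leq_trans jj').
  by have [_ /(_ dj') -> _] := stepS j'; rewrite cj' cj addnS.
(* An index of the target that the counter has not passed at time [i]. *)
have [d cd Td] := recur (s i).2.
have [j ij cj] := counter (d - (s i).2).
have [j' jj' [cj' dj']] := ends j.
rewrite /done cj' cj subnKC // Td in dj'.
have ij' := leq_trans ij jj'; exists j' => //.
by case: dj' => // nr; have [n /nr] := reachk _ ij'.
Qed.

End FairRun.

(** * Maximal consistent sets *)

Section MaximalConsistent.
Variables (P : Type) (L : eqType).
Hypothesis infL : exists e : nat -> L, bijective e.
Implicit Types (A B C : ltl P) (M N : set (ltl P)).

(** Necessitation is applied only inside [provable] and never to assumptions, so the deduction
    theorem holds. *)
Inductive derives (S : set (ltl P)) : ltl P -> Prop :=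
| derives_ass A : S A -> derives S A
| derives_thm A : provable L A -> derives S A
| derives_mp A B : derives S (LImp A B) -> derives S A -> derives S B.

Lemma derives_sub (S S' : set (ltl P)) A :
  S `<=` S' -> derives S A -> derives S' A.
Proof.
move=> sub; elim=> {A} [A /sub|A|A B _ HAB _].
- exact: derives_ass.
- exact: derives_thm.
- exact: derives_mp.
Qed.

Lemma derives_impI (S : set (ltl P)) A B :
  derives (A |` S) B -> derives S (LImp A B).
Proof.
have K C : derives S C -> derives S (LImp A C).
  by apply: derives_mp; apply/derives_thm/provable_K.
elim=> {B} [B [->|SB]|B pB|B C _ HBC _ HB].
- apply: (@derives_mp _ (LImp A (LImp A A))); last exact/derives_thm/provable_K.
  apply: (@derives_mp _ (LImp A (LImp (LImp A A) A))).
    exact/derives_thm/provable_S.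
  exact/derives_thm/provable_K.
- exact/K/derives_ass.
- exact/K/derives_thm.
- apply: derives_mp HB; apply: derives_mp HBC.
  exact/derives_thm/provable_S.
Qed.

Lemma derives_set0 A : derives set0 A -> provable L A.
Proof. by elim=> {A} // A B _ HAB _; exact: provable_mp. Qed.

(** Finiteness of derivations, in the form needed for chains in Zorn's lemma: of two members of a
    chain, the larger derives both premises. *)
Lemma derives_bigcup (Fam : set (set (ltl P))) S A :
  Fam S -> total_on Fam subset -> derives (\bigcup_(S in Fam) S) A ->
  exists2 S, Fam S & derives S A.
Proof.
move=> FS tot; elim=> {A} [A [S' FS' S'A]|A pA|A B _ [S1 F1 H1] _ [S2 F2 H2]].
- by exists S' => //; exact: derives_ass.
- by exists S => //; exact: derives_thm.
- have [S12|S21] := tot _ _ F1 F2.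
    by exists S2 => //; apply: derives_mp H2; exact: derives_sub H1.
  by exists S1 => //; apply: derives_mp H1 _; exact: derives_sub H2.
Qed.

(** Maximality is expressed by the truth-table clause for implication, which together with [mcs_bot]
    puts exactly one of A and its negation into M. *)
Record mcs M : Prop := Mcs {
  mcs_thm : forall A, provable L A -> M A;
  mcs_imp : forall A B, M (LImp A B) <-> (M A -> M B);
  mcs_bot : ~ M LBot }.

Lemma lindenbaum A : (forall M, mcs M -> M A) -> provable L A.
Proof.
move=> HM; apply: contrapT => npA.
pose nA := LImp A LBot.
(* The negation of A is added from outside rather than required in [S], so that the empty chain has
   the consistent union [set0]. *)
pose cons (S : set (ltl P)) := ~ derives (nA |` S) LBot.
have [S [cS maxS]] : exists S, cons S /\ forall S', S `<` S' -> ~ cons S'.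
  apply: Zorn_bigcup => Fam FC tot.
  have [[S FS]|F0] := pselect (exists S, Fam S).
    move=> dU.
    pose Fam' := (fun S => nA |` S) @` Fam.
    have [|||_ [S' /FC cS' <-] //] := @derives_bigcup Fam' (nA |` S) LBot.
    - by exists S.
    - move=> _ _ [S1 F1 <-] [S2 F2 <-].
      by have [H|H] := tot _ _ F1 F2; [left|right]; exact: setUS.
    - apply: derives_sub dU => B [->|[S' FS' S'B]].
        by exists (nA |` S); [exists S|left].
      by exists (nA |` S'); [exists S'|right].
  move=> dU; apply: npA; apply: provable_mp (provable_DNE A) _.
  apply: derives_set0; apply: derives_impI; apply: derives_sub dU.
  by move=> B [->|[S' FS']]; [left|case: F0; exists S'].
pose D := nA |` S.
have inD B : derives D B -> D B.
  move=> dB; right; apply: contrapT => nSB.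
  apply: (maxS (B |` S)).
    by split; [move=> ? ?; right|move=> sub; apply/nSB/sub; left].
  move=> dBS; apply: cS; apply: derives_mp dB; apply: derives_impI.
  by apply: derives_sub dBS => C [|[|]]; [right; left|left|right; right].
have nB B : ~ D B -> D (LImp B LBot).
  move=> nDB; apply/inD/derives_impI; apply: contrapT => cB.
  apply: (maxS (B |` S)).
    split; first by move=> ? ?; right.
    by move=> sub; apply: nDB; right; apply: sub; left.
  move=> dB; apply: cB; apply: derives_sub dB.
  by move=> C [|[|]]; [right; left|left|right; right].
have mD : mcs D.
  split=> [B pB|B C|DB]; [exact/inD/derives_thm| |exact/cS/derives_ass].
  split=> [DBC DB|DBC].
    by apply/inD/(@derives_mp _ B); exact: derives_ass.
  have [DB|/nB DB] := pselect (D B).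
    apply/inD/(@derives_mp _ C); last exact/derives_ass/DBC.
    exact/derives_thm/provable_K.
  apply/inD/derives_impI/(derives_mp (derives_thm _ (provable_DNE C))).
  apply: derives_impI; apply: (@derives_mp _ B); apply: derives_ass.
    by right; right.
  by right; left.
apply: cS; apply: (@derives_mp _ A); apply: derives_ass; first by left.
exact: HM.
Qed.

Lemma mcs_neg M A : mcs M -> M (LImp A LBot) <-> ~ M A.
Proof. by move=> mM; rewrite (mcs_imp mM); have := mcs_bot mM; tauto. Qed.

Lemma mcs_mp M A B : mcs M -> provable L (LImp A B) -> M A -> M B.
Proof. by move=> mM /(mcs_thm mM)/(mcs_imp mM). Qed.

Definition next M : set (ltl P) := [set A | M (LX A)].

Lemma mcs_next M : mcs M -> mcs (next M).
Proof.
move=> mM; split=> [A pA|A B|].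
- exact/(mcs_thm mM)/provable_necX.
- rewrite /next /=; split=> [MAB|MAB].
    by apply/(mcs_imp mM); apply: mcs_mp MAB => //; exact: provable_KX.
  have necX C D : provable L (LImp C D) -> M (LX C) -> M (LX D).
    move=> /(provable_necX infL)/(mcs_thm mM) MCD.
    by apply/(mcs_imp mM); apply: mcs_mp MCD => //; exact: provable_KX.
  have [MA|nMA] := pselect (M (LX A)).
    by apply: (necX B); [exact: provable_K|exact: MAB].
  apply: (necX (LImp A LBot)).
    apply: lindenbaum => N mN; rewrite !(mcs_imp mN).
    by have := mcs_bot mN; tauto.
  by apply: (mcs_mp mM (provable_negX infL A)); apply/mcs_neg.
- by move=> MX; apply: (mcs_bot mM); exact: (mcs_mp mM (provable_XBot P infL)).
Qed.

(** By [lindenbaum], an implication valid in all maximal consistent sets is a theorem, so both D ->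
    A and D -> X D may be put under [LG] and fed to the induction axiom. *)
Lemma mcs_ind M D A : mcs M ->
  (forall N, mcs N -> N D -> N A /\ next N D) -> M D -> M (LG A).
Proof.
move=> mM DP MD.
have MGD : M (LG D).
  apply/(mcs_imp mM): MD; apply: (mcs_mp mM (provable_ind infL D)).
  apply/(mcs_thm mM)/(provable_necG infL)/lindenbaum => N mN.
  by apply/(mcs_imp mN) => /(DP _ mN)[].
apply/(mcs_imp mM): MGD; apply: (mcs_mp mM (provable_KG infL D A)).
apply/(mcs_thm mM)/(provable_necG infL)/lindenbaum => N mN.
by apply/(mcs_imp mN) => /(DP _ mN)[].
Qed.

Lemma mcs_and M A B : mcs M ->
  M (LImp (LImp A (LImp B LBot)) LBot) <-> M A /\ M B.
Proof.
move=> mM; rewrite !(mcs_imp mM); have := mcs_bot mM.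
by have := EM (M A); have := EM (M B); tauto.
Qed.

(** From right to left, the conjunction of A and X G A, written with implication and falsum, is the
    invariant for [mcs_ind]. *)
Lemma mcs_G M A : mcs M -> M (LG A) <-> M A /\ next M (LG A).
Proof.
move=> mM; split=> [MG|[MA MXG]].
  by split; apply: mcs_mp MG => //; [exact: provable_GE|exact: provable_GXG].
apply: (@mcs_ind _ (LImp (LImp A (LImp (LX (LG A)) LBot)) LBot)) => //.
  move=> N mN /(mcs_and _ _ mN)[NA NXG]; split=> //.
  apply/mcs_and; first exact: mcs_next.
  have mnN := mcs_next mN; split.
    by apply: mcs_mp NXG => //; exact: provable_GE.
  by apply: (mcs_mp mnN _ NXG); exact: provable_GXG.
exact/mcs_and.
Qed.

Lemma mcs_U M A B : mcs M ->
  M (LU A B) <-> M B \/ M A /\ next M (LU A B).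
Proof.
move=> mM.
have := mcs_thm mM (@provable_UI1 P L A B).
have := mcs_thm mM (provable_UI2 infL A B).
have := mcs_thm mM (provable_UE1 infL A B).
have := mcs_thm mM (provable_UE2 infL A B).
rewrite !(mcs_imp mM) /next /=; have := mcs_bot mM.
by have := EM (M B); tauto.
Qed.

Lemma mcs_U_eventually M A B : mcs M -> M (LU A B) -> ~ M (LG (LImp B LBot)).
Proof.
move=> mM; have := mcs_thm mM (provable_UE3 infL A B).
by rewrite !(mcs_imp mM); have := mcs_bot mM; tauto.
Qed.

(** * Filtration through a finite list of formulas *)

Definition agree (Phi : seq (ltl P)) M N :=
  forall A, List.In A Phi -> M A <-> N A.

(** For empty [Phi], the property is constant on maximal consistent sets. A further formula A splits
    it into two properties, each determined by the remaining formulas: some agreeing set satisfies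
    [Q] and contains A, or satisfies [Q] and omits A. *)
Lemma definable Phi (Q : set (ltl P) -> Prop) :
  (forall M N, mcs M -> mcs N -> agree Phi M N -> Q M -> Q N) ->
  exists D, forall M, mcs M -> M D <-> Q M.
Proof.
elim: Phi Q => [|A Phi IH] Q Qagree.
  have [[N [mN QN]]|nQ] := pselect (exists N, mcs N /\ Q N).
    exists (LImp LBot LBot) => M mM; split=> _; first exact: Qagree QN.
    exact/(mcs_imp mM).
  exists LBot => M mM; split=> [/(mcs_bot mM)//|QM]; case: nQ; by exists M.
have restrict (b : Prop) : exists D, forall M, mcs M ->
    M D <-> exists N, [/\ mcs N, agree Phi M N, N A <-> b & Q N].
  apply: IH => M N mM mN MN [K [mK MK KA QK]].
  by exists K; split=> // B BPhi; rewrite -MN // MK.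
have [D1 D1P] := restrict True; have [D0 D0P] := restrict False.
(* The conjunction of A -> D1 and not A -> D0. *)
exists (LImp (LImp (LImp A D1) (LImp (LImp (LImp A LBot) D0) LBot)) LBot).
move=> M mM.
rewrite mcs_and // 2!(mcs_imp mM) mcs_neg // D1P // D0P //.
split=> [[H1 H0]|QM].
  have [MA|nMA] := pselect (M A).
    have [N [mN MN NA]] := H1 MA; apply: Qagree => //.
    by move=> B /= [<-|/MN]; tauto.
  have [N [mN MN NA]] := H0 nMA; apply: Qagree => //.
  by move=> B /= [<-|/MN]; tauto.
by split=> ?; exists M; split.
Qed.

(** The least filtration of [next]: an edge starting at a set also starts at every set that agrees
    with it on [Phi]. *)
Definition filtered_step Phi (M M' : {M | mcs M}) :=
  exists N, [/\ mcs N, agree Phi (sval M) N & agree Phi (next N) (sval M')].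

Lemma filtered_step_total Phi (M : {M | mcs M}) :
  exists M' : {M | mcs M}, filtered_step Phi M M'.
Proof.
exists (exist _ _ (mcs_next (svalP M))), (sval M).
by split=> //; exact: svalP.
Qed.

(** If every reachable set contained A, the formula defining the sets that agree with a reachable
    one would be an invariant implying A, and G A would be in M. *)
Lemma reach_neg_G Phi (M : {M | mcs M}) A :
  (forall N K, mcs N -> mcs K -> agree Phi N K -> N A -> K A) ->
  ~ sval M (LG A) ->
  exists n, reach (filtered_step Phi) (fun S => ~ sval S A) n M.
Proof.
move=> APhi; apply: contra_notP => nr.
(* Since [reach] unfolds from the first step, reachability is stated through targets: this avoids
   appending a step at the end of a path. *)
pose reachable (N : {M | mcs M}) := forall T n,
  reach (filtered_step Phi) T n N ->
  exists n', reach (filtered_step Phi) T n' M.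
have [|D DP] := @definable Phi (fun N =>
    exists N' : {M | mcs M}, reachable N' /\ agree Phi N (sval N')).
  move=> N K mN mK NK [N' [rN' NN']]; exists N'; split=> // B BPhi.
  by rewrite -NK // NN'.
apply: (@mcs_ind _ D); first exact: svalP.
  move=> N mN /(DP _ mN)[N' [rN' NN']]; split.
    apply: (APhi (sval N')) => //; first exact: svalP.
      by move=> B /NN'; tauto.
    apply: contrapT => N'A; apply: nr.
    exact: (rN' (fun S => ~ sval S A) 0).
  apply/DP; first exact: mcs_next.
  pose N'' : {M | mcs M} := exist _ _ (mcs_next mN).
  exists N''; split=> // T n rT; apply: (rN' T n.+1); exists N'' => //.
  by exists N; split=> // B BPhi; rewrite NN'.
apply/DP; first exact: svalP.
by exists M; split=> // T n; exists n.
Qed.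

(** * The truth lemma along a fair run, and completeness *)

Fixpoint subformulas A := A :: match A with
  | LVar _ | LBot => [::]
  | LImp B C | LU B C => subformulas B ++ subformulas C
  | LG B | LX B => subformulas B
  end.

Lemma in_subformulas A : List.In A (subformulas A).
Proof. by case: A => *; left. Qed.

Lemma completeness A : ltl_valid A -> provable L A.
Proof.
move=> validA; apply: lindenbaum => M mM.
pose Phi := subformulas A.
(* Refuting B is the eventuality of a failing G B; satisfying B is that of an until with right
   argument B. *)
pose targets (B : ltl P) : seq ({M | mcs M} -> Prop) :=
  [:: fun S => ~ sval S B; fun S => sval S B].
pose Ts := List.flat_map targets Phi.
(* The cyclic enumeration makes each target recur; the default is never read, as A lies in [Phi] and
   so [Ts] is nonempty. *)
pose T k := List.nth (k %% size Ts) Ts (fun _ => False).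
have [sigma [sigma0 stepP fairP]] :=
  fair_run (filtered_step_total Phi) T (exist _ _ mM).
have fair B t i : List.In B Phi -> List.In t (targets B) ->
    (forall j, i <= j -> exists n, reach (filtered_step Phi) t n (sigma j)) ->
    exists2 j, i <= j & t (sigma j).
  move=> BPhi tB.
  have tTs : List.In t Ts by apply/List.in_flat_map; exists B.
  have [k [/ltP ks kt]] := List.In_nth Ts t (fun _ => False) tTs.
  have Tk : T k = t by rewrite /T modn_small.
  rewrite -Tk; apply: fairP => c.
  exists (c * size Ts + k); last by rewrite /T modnMDl.
  by rewrite (leq_trans _ (leq_addr _ _)) // leq_pmulr // (leq_trans _ ks).
pose V n : set P := fun p => sval (sigma n) (LVar p).
have mcsS n : mcs (sval (sigma n)) by exact: svalP.
(* The unfolding laws hold at the intermediate set [N] of an edge, and agreement on [Phi] carries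
   them to its two ends. *)
have stepX n B : List.In (LX B) Phi -> List.In B Phi ->
    sval (sigma n) (LX B) <-> sval (sigma n.+1) B.
  by move=> XB BP; have [N [mN /(_ _ XB) -> /(_ _ BP) <-]] := stepP n.
have stepG n B : List.In (LG B) Phi -> List.In B Phi ->
    sval (sigma n) (LG B) <-> sval (sigma n) B /\ sval (sigma n.+1) (LG B).
  move=> GB BP; have [N [mN H H']] := stepP n.
  by rewrite !H // -H' // mcs_G.
have stepU n B C : List.In (LU B C) Phi -> List.In B Phi -> List.In C Phi ->
    sval (sigma n) (LU B C) <->
    sval (sigma n) C \/ sval (sigma n) B /\ sval (sigma n.+1) (LU B C).
  move=> UP BP CP; have [N [mN H H']] := stepP n.
  by rewrite !H // -H' // mcs_U.
have truth B : List.incl (subformulas B) Phi ->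
    forall n, sval (sigma n) B <-> ltl_sat V n B.
  elim: B => [p||B IHB C IHC|B IHB|B IHB|B IHB C IHC] /= sub n.
  - by [].
  - by split=> // /(mcs_bot (mcsS n)).
  - rewrite mcs_imp // IHB ?IHC //.
      by move=> D DC; apply: sub; right; apply/List.in_or_app; right.
    by move=> D DC; apply: sub; right; apply/List.in_or_app; left.
  - have GB : List.In (LG B) Phi by apply: sub; left.
    have BP : List.In B Phi by apply: sub; right; exact: in_subformulas.
    have {}IHB := IHB (fun D DB => sub D (or_intror DB)).
    split=> [sG m /subnKC <-|sB].
      apply/IHB; move: (m - n) => d; elim: d n sG => [|d IHd] n sG.
        by rewrite addn0; case/stepG: sG.
      by rewrite addnS -addSn; apply: IHd; case/stepG: sG.
    (* While B holds, a failing G B keeps failing, so a refutation of B stays reachable and fairness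
       produces one. *)
    apply: contrapT => nG.
    have nGj d : ~ sval (sigma (n + d)) (LG B).
      elim: d => [|d IHd]; first by rewrite addn0.
      move=> G'; apply: IHd; apply/stepG => //; rewrite -addnS; split=> //.
      by apply/IHB/sB/leq_addr.
    have [||j nj] := fair B (fun S => ~ sval S B) n BP; first by left.
      move=> j /subnKC <-; apply: reach_neg_G => // N K _ _ NK NB.
      exact/NK.
    by apply; apply/IHB/sB.
  - have BP : List.In B Phi by apply: sub; right; exact: in_subformulas.
    rewrite stepX //; last by apply: sub; left.
    by apply: IHB => D DB; apply: sub; right.
  - have UP : List.In (LU B C) Phi by apply: sub; left.
    have subB : List.incl (subformulas B) Phi.
      by move=> D DC; apply: sub; right; apply/List.in_or_app; left.
    have subC : List.incl (subformulas C) Phi.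
      by move=> D DC; apply: sub; right; apply/List.in_or_app; right.
    have BP := subB _ (in_subformulas B); have CP := subC _ (in_subformulas C).
    move: (IHB subB) (IHC subC) => {}IHB {}IHC.
    split=> [sU|[m [/subnKC <- sC sB]]].
      (* Without a witness, the until persists along the run with B true throughout; C then stays
         reachable, and fairness yields a witness after all. *)
      apply: contrapT => nex.
      have Uj d : sval (sigma (n + d)) (LU B C) /\
          forall m, n <= m -> m < n + d -> ltl_sat V m B.
        elim: d => [|d [sUd sBd]].
          by rewrite addn0; split=> // m nm /(leq_ltn_trans nm); rewrite ltnn.
        case/stepU: sUd => // [/IHC sC|[/IHB sB sUd]].
          by case: nex; exists (n + d); rewrite leq_addr.
        rewrite addnS; split=> // m nm.
        rewrite ltnS leq_eqVlt => /predU1P[->//|].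
        exact: sBd.
      have [||j nj] := fair C (fun S => sval S C) n CP; first by right; left.
        move=> j /subnKC <-; have [sUj _] := Uj (j - n).
        have nG := mcs_U_eventually (mcsS _) sUj.
        have [|n' r] := @reach_neg_G Phi _ (LImp C LBot) _ nG.
          by move=> N K mN mK NK; rewrite !mcs_neg // NK.
        (* Omitting the negation of C and containing C are the same target. *)
        exists n'; congr (reach _ _ _ _): r; apply: funext => N; apply: propext.
        by rewrite mcs_neg; [split=> [/contrapT|? []]|exact: svalP].
      move=> /IHC sC; apply: nex; exists j; split=> //.
      by have := (Uj (j - n)).2; rewrite subnKC.
    move: (m - n) sC sB => d; elim: d n => [|d IHd] n sC sB.
      by apply/stepU => //; left; apply/IHC; rewrite addn0 in sC.
    apply/stepU => //; right; split.
      by apply/IHB/sB; rewrite ?leqnn // addnS ltnS leq_addr.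
    apply: IHd; first by rewrite addSn -addnS.
    by move=> k nk; rewrite addSn -addnS; apply: sB; exact: ltnW.
have -> : M = sval (sigma 0) by rewrite sigma0.
by apply/truth => [D //|]; exact: validA.
Qed.

End MaximalConsistent.

Theorem theorem4 (P : Type) (L : eqType)
    (hL : exists e : nat -> L, bijective e) (A : ltl P) :
  ltl_valid A -> ltl_provable L A.
Proof.
move=> /(completeness hL) provA; case: (hL) => e _; exists (e 0).
have [C dC C0] := provA (e 0).
have {C0} C0 : C = set0 by apply/seteqP; split=> // psi /C0.
rewrite C0 in dC; split=> //.
by exists (e 0); split=> //; exists A.
Qed.
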